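(* Let $0<\alpha<1$ be fixed and $f_i=1/i^\alpha$ for $i\in[n]$. Let $n,B,k\in\mathbb{N}$ with $k\ge1$ and $B\le n/k$. Let $h_1,\dots,h_k:[n]\to[B]$ be independent, truly (uniformly) random hash functions, and for $i\in[n]$ define $\tilde f_i=\min_{\ell\in[k]}\big(\sum_{j\in[n]}[h_\ell(j)=h_\ell(i)]f_j\big)$. Then for every $i\in[n]$, $\mathbb{E}[|\tilde f_i-f_i|]=\Theta\!\left(\frac{n^{1-\alpha}}{B}\right)$, with implied constants depending only on $\alpha$.
   Context: $[E]$ is the indicator of event $E$. This is Count-Min on generalized Zipfian frequencies with exponent $\alpha$.
   Formalization: The lower bound is stated for n ≥ 2 only (the upper bound for all n ≥ 1), since for n = B = k = 1 the error is identically 0 while n^{1-α}/B = 1; B ≥ 1 is made explicit. *)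

(* Defs.v *)
From HB Require Import structures.
From mathcomp Require Import all_boot all_order all_algebra.
From mathcomp Require Import all_classical all_reals all_analysis.

Set Implicit Arguments.
Unset Strict Implicit.
Unset Printing Implicit Defensive.

Import Order.TTheory GRing.Theory Num.Theory.
Import numFieldNormedType.Exports.

Local Open Scope classical_set_scope.
Local Open Scope ring_scope.

(* The index [i : 'I_n] stands for the (1-based) item [i.+1] of [n]. *)
Definition zipf (R : realType) (alpha : R) (n : nat) (i : 'I_n) : R :=
  1 / (i.+1%:R `^ alpha).

Definition bucket_load (R : realType) (n B : nat) (f : 'I_n -> R)
    (g : {ffun 'I_n -> 'I_B}) (i : 'I_n) : R :=
  \sum_(j < n) (g j == g i)%:R * f j.

(* For nonnegative [f] no bucket load exceeds the total [\sum_j f j], so for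
   [0 < k] the starting value of the iterated minimum is immaterial; see
   [count_minP]. *)
Definition count_min (R : realType) (n B k : nat) (f : 'I_n -> R)
    (g : 'I_k -> {ffun 'I_n -> 'I_B}) (i : 'I_n) : R :=
  \big[Num.min/(\sum_(j < n) f j)]_(l < k) bucket_load f (g l) i.

Lemma zipf_ge0 (R : realType) (alpha : R) (n : nat) (i : 'I_n) :
  0 <= zipf alpha i.
Proof. by rewrite /zipf div1r invr_ge0 powR_ge0. Qed.

Lemma count_minP (R : realType) (n B k : nat) (f : 'I_n -> R)
    (g : 'I_k -> {ffun 'I_n -> 'I_B}) (i : 'I_n) :
  (forall j, 0 <= f j) -> (0 < k)%N ->
  (exists l, count_min f g i = bucket_load f (g l) i) /\
  (forall l, count_min f g i <= bucket_load f (g l) i).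
Proof.
move=> f0 k0; split; last by move=> l; exact: bigmin_le.
have load_le l : bucket_load f (g l) i <= \sum_(j < n) f j.
  by apply: ler_sum => j _; rewrite ler_piMl // lern1 leq_b1.
have [l _ eq_l] : {l | l \in xpredT &
    count_min f g i = bucket_load f (g l) i}.
  by apply: (eq_bigmin (Ordinal k0)) => // l _; exact: load_le.
by exists l.
Qed.

(* Random elements of a finite type [S], which carries the discrete
   sigma-algebra: measurability is measurability of the preimages of points,
   and every subset of [S] is an admissible event in the product rule. *)
Section discrete_random_elements.
Context (d : measure_display) (T : measurableType d) (R : realType).
Variable P : probability T R.
Local Open Scope ereal_scope.

Definition random_element (S : finType) (X : T -> S) : Prop :=
  forall s : S, measurable (X @^-1` [set s]).

Definition uniformly_distributed (S : finType) (X : T -> S) : Prop :=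
  forall s : S, P (X @^-1` [set s]) = ((#|S|%:R)^-1)%:E.

Definition mutually_independent (I S : finType) (X : I -> T -> S) : Prop :=
  forall (J : {set I}) (A : I -> set S),
    P (\bigcap_(l in [set` J]) (X l @^-1` A l))
    = \prod_(l in J) P (X l @^-1` A l).

End discrete_random_elements.

(* Main.v *)
(** Write [X_l] for the mass of the items other than [i] hashed by [h_l] to the
    bucket of [i]; the error is the minimum of the [X_l].  It is at most [X_1],
    whose mean is at most [B^-1 * \sum_j f_j <= n^(1-alpha) / ((1-alpha) B)].
    Conversely [X_l >= n^(-alpha) Y_l], where [Y_l] is binomial with mean
    [m = (n-1)/B].  The Chernoff bound [P(Y_l < m/4) <= exp(-m/4)], together
    with [1 - exp(-x) >= exp(-1/x)], gives
    [P(Y_l >= m/4)^k >= exp(-4k/m) >= exp(-8)], because [k B <= n <= 2(n-1)]. *)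

Require Import Defs.
From HB Require Import structures.
From mathcomp Require Import all_boot all_order all_algebra.
From mathcomp Require Import all_classical all_reals all_analysis.
From mathcomp Require Import measurable_realfun ring lra.

Set Implicit Arguments.
Unset Strict Implicit.
Unset Printing Implicit Defensive.

Import Order.TTheory GRing.Theory Num.Theory.
Import numFieldNormedType.Exports.
Local Open Scope ring_scope.

Section average.
Variable R : numFieldType.
Implicit Types I S : finType.

Definition average S (phi : S -> R) : R := #|S|%:R^-1 * \sum_s phi s.

Lemma eq_average S (phi psi : S -> R) :
  phi =1 psi -> average phi = average psi.
Proof. by move=> eq_phi; congr (_ * _); exact: eq_bigr. Qed.

Lemma ler_average S (phi psi : S -> R) :
  (forall s, phi s <= psi s) -> average phi <= average psi.
Proof. by move=> le_phi; rewrite ler_wpM2l ?invr_ge0 ?ler_sum. Qed.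

Lemma average_ge0 S (phi : S -> R) : (forall s, 0 <= phi s) -> 0 <= average phi.
Proof. by move=> phi0; rewrite mulr_ge0 ?invr_ge0 ?sumr_ge0. Qed.

Lemma average_cst S (c : R) : (0 < #|S|)%N -> average (fun _ : S => c) = c.
Proof.
move=> S0; rewrite /average sumr_const -[c *+ _]mulr_natl mulKf //.
by rewrite pnatr_eq0 -lt0n.
Qed.

Lemma averageB S (phi psi : S -> R) :
  average (fun s => phi s - psi s) = average phi - average psi.
Proof. by rewrite /average sumrB mulrBr. Qed.

Lemma averageZ S (c : R) (phi : S -> R) :
  average (fun s => c * phi s) = c * average phi.
Proof. by rewrite /average -mulr_sumr mulrCA. Qed.

Lemma average_sum S J (r : seq J) (Q : pred J) (phi : J -> S -> R) :
  average (fun s => \sum_(j <- r | Q j) phi j s) =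
  \sum_(j <- r | Q j) average (phi j).
Proof. by rewrite /average exchange_big mulr_sumr. Qed.

Lemma average_pred1 S (a : S) : average (fun s => (s == a)%:R) = #|S|%:R^-1.
Proof.
by rewrite /average (bigD1 a) //= eqxx big1 ?addr0 ?mulr1 // => s /negbTE ->.
Qed.

Lemma average_ffun_prod I S (F : I -> S -> R) :
  average (fun g : {ffun I -> S} => \prod_j F j (g j)) = \prod_j average (F j).
Proof.
rewrite /average card_ffun big_split prodr_const bigA_distr_bigA.
by rewrite natrX exprVn.
Qed.

(* Conditionally on [g i], the other values of a uniform [g] are independent. *)
Lemma average_ffun_prod_given I S (i : I) (psi : S -> I -> S -> R) :
  average (fun g : {ffun I -> S} => \prod_(j | j != i) psi (g i) j (g j)) =
  average (fun b => \prod_(j | j != i) average (psi b j)).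
Proof.
pose F b j c : R := if j == i then (c == b)%:R else psi b j c.
have F_off b j : j != i -> F b j = psi b j by rewrite /F => /negbTE ->.
transitivity (average (fun g : {ffun I -> S} => \sum_b \prod_j F b j (g j))).
  apply: eq_average => g; rewrite (bigD1 (g i)) //= [X in _ + X]big1 ?addr0.
    rewrite [RHS](bigD1 i) //= {1}/F !eqxx mul1r.
    by apply: eq_bigr => j /F_off ->.
  by move=> b bg; rewrite (bigD1 i) //= /F eqxx eq_sym (negbTE bg) mul0r.
rewrite average_sum /average mulr_sumr; apply: eq_bigr => b _.
rewrite -/(average _) average_ffun_prod (bigD1 i) //= {1}/F eqxx average_pred1.
by congr (_ * _); apply: eq_bigr => j /F_off ->.
Qed.

End average.

Section hash_collisions.
Variables (I S : finType) (R : numFieldType).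
Implicit Types (g : {ffun I -> S}) (i j : I) (f : I -> R).

Definition overload f g i : R := \sum_(j | j != i) (g j == g i)%:R * f j.

Definition collisions g i : nat := \sum_(j | j != i) (g j == g i).

Definition mean_collisions i : R :=
  average (fun g : {ffun I -> S} => (collisions g i)%:R).

Lemma overload_ge0 f g i : (forall j, 0 <= f j) -> 0 <= overload f g i.
Proof. by move=> f0; apply: sumr_ge0 => j _; rewrite mulr_ge0. Qed.

Lemma overload_cst c g i : overload (fun=> c) g i = c * (collisions g i)%:R.
Proof. by rewrite /overload /collisions -mulr_suml -natr_sum mulrC. Qed.

Lemma overload_ge_collisions c f g i : (forall j, c <= f j) ->
  c * (collisions g i)%:R <= overload f g i.
Proof.
by move=> cf; rewrite -overload_cst; apply: ler_sum => j _; rewrite ler_wpM2l.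
Qed.

Hypothesis S_gt0 : (0 < #|S|)%N.

Lemma average_collision i j : j != i ->
  average (fun g => (g j == g i)%:R) = #|S|%:R^-1 :> R.
Proof.
move=> ji.
pose psi (b : S) j' (c : S) : R := if j' == j then (c == b)%:R else 1.
transitivity (average (fun g => \prod_(j' | j' != i) psi (g i) j' (g j'))).
  apply: eq_average => g; rewrite (bigD1 j) //= {1}/psi eqxx big1 ?mulr1 //.
  by move=> j' /andP[_ /negbTE]; rewrite /psi => ->.
rewrite average_ffun_prod_given -[RHS](average_cst _ S_gt0).
apply: eq_average => b.
rewrite (bigD1 j) //= big1 => [|j' /andP[_ /negbTE jj']].
  by rewrite mulr1 /psi eqxx average_pred1.
by rewrite /psi jj' average_cst.
Qed.

Lemma average_overload f i :
  average (fun g => overload f g i) = #|S|%:R^-1 * \sum_(j | j != i) f j.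
Proof.
rewrite average_sum mulr_sumr; apply: eq_bigr => j ji.
rewrite -(average_collision ji) mulrC -averageZ.
by under eq_average do rewrite mulrC.
Qed.

Lemma mean_collisionsE i : mean_collisions i = #|I|.-1%:R / #|S|%:R.
Proof.
rewrite /mean_collisions.
under eq_average do rewrite -[_%:R]mul1r -overload_cst.
by rewrite average_overload sumr_const cardC1 mulrC.
Qed.

End hash_collisions.

Section lower_tail_of_collisions.
Variables (R : realType) (I S : finType).
Hypothesis S_gt0 : (0 < #|S|)%N.
Implicit Types (g : {ffun I -> S}) (i : I).

Lemma average_expR_collisions (t : R) i :
  average (fun g => expR (t * (collisions g i)%:R)) =
  (1 - (1 - expR t) / #|S|%:R) ^+ #|I|.-1.
Proof.
pose psi (b : S) (_ : I) (c : S) : R := 1 - (1 - expR t) * (c == b)%:R.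
transitivity (average (fun g => \prod_(j | j != i) psi (g i) j (g j))).
  apply: eq_average => g; rewrite natr_sum mulr_sumr expR_sum.
  apply: eq_bigr => j _; rewrite /psi; case: eqP => _.
    by rewrite !mulr1 opprB addrC subrK.
  by rewrite !mulr0 subr0 expR0.
rewrite average_ffun_prod_given -[RHS](average_cst _ S_gt0).
apply: eq_average => b.
under eq_bigr do rewrite averageB averageZ average_cst // average_pred1.
by rewrite prodr_const cardC1.
Qed.

Lemma average_expR_collisions_le (t : R) i :
  average (fun g => expR (t * (collisions g i)%:R)) <=
  expR ((expR t - 1) * mean_collisions S R i).
Proof.
rewrite average_expR_collisions mean_collisionsE // mulrCA expRM_natl.
have SV0 : 0 < #|S|%:R^-1 :> R by rewrite invr_gt0 ltr0n.
have SV1 : #|S|%:R^-1 <= 1 :> R by rewrite invf_le1 ?ltr0n ?ler1n.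
have et0 : 0 < expR t by exact: expR_gt0.
rewrite lerXn2r ?nnegrE ?expR_ge0 //; first by nra.
by rewrite -[expR t - 1]opprB mulNr; exact: expR_ge1Dx.
Qed.

Lemma markov_expRN_average (Q : finType) (phi : Q -> R) (x : R) :
  (0 < #|Q|)%N ->
  1 - expR x * average (fun s => expR (- phi s)) <=
  average (fun s => (x <= phi s)%R%:R).
Proof.
move=> Q0; rewrite -averageZ -[X in X - _](average_cst _ Q0) -averageB.
apply: ler_average => s; rewrite -expRD; case: (leP x) => [_|lt_phi_x].
  by rewrite lerBlDr lerDl expR_ge0.
by rewrite subr_le0 -expR0 ler_expR; lra.
Qed.

Lemma average_many_collisions_ge i :
  1 - expR (- (mean_collisions S R i / 4)) <=
  average (fun g => (mean_collisions S R i / 4 <= (collisions g i)%:R)%R%:R).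
Proof.
set m := mean_collisions S R i.
have m0 : 0 <= m by exact: average_ge0.
have ffun0 : (0 < #|{: {ffun I -> S}}|)%N by rewrite card_ffun expn_gt0 S_gt0.
apply: le_trans (markov_expRN_average _ _ ffun0); rewrite lerD2l lerN2.
have mgf : average (fun g => expR (- (collisions g i)%:R)) <= expR (- (m / 2)).
  under eq_average do rewrite -mulN1r.
  apply: le_trans (average_expR_collisions_le _ i) _; rewrite ler_expR -/m.
  have e2 : expR (-1) <= 2^-1 :> R.
    rewrite expRN lef_pV2 ?posrE ?expR_gt0 //.
    by have := @expR_ge1Dx R 1; lra.
  by nra.
apply: le_trans (ler_wpM2l (expR_ge0 _) mgf) _.
by rewrite -expRD ler_expR; lra.
Qed.

End lower_tail_of_collisions.

Section count_min_error.
Variables (R : realType) (n B k : nat) (f : 'I_n -> R).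
Implicit Types (g : {ffun 'I_n -> 'I_B}) (h : 'I_k -> {ffun 'I_n -> 'I_B}).

Definition count_min_error h (i : 'I_n) : R := `|count_min f h i - f i|.

Lemma bucket_loadE g i : bucket_load f g i = f i + overload f g i.
Proof. by rewrite /bucket_load (bigD1 i) //= eqxx mul1r. Qed.

Lemma count_min_errorP h i : (forall j, 0 <= f j) -> (0 < k)%N ->
  (exists l, count_min_error h i = overload f (h l) i) /\
  (forall l, count_min_error h i <= overload f (h l) i).
Proof.
move=> f0 k0; have [[l cE] le_load] := count_minP h i f0 k0.
have errE : count_min_error h i = overload f (h l) i.
  rewrite /count_min_error cE bucket_loadE addrAC subrr add0r.
  by rewrite ger0_norm ?overload_ge0.
split=> [|l']; first by exists l.
by rewrite errE -(lerD2l (f i)) -!bucket_loadE -cE.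
Qed.

End count_min_error.

Lemma lee_prod (R : realDomainType) (I : Type) (r : seq I) (Q : pred I)
    (u v : I -> \bar R) :
  (forall i, Q i -> 0 <= u i <= v i)%E ->
  (\prod_(i <- r | Q i) u i <= \prod_(i <- r | Q i) v i)%E.
Proof.
move=> uv; pose le0 (x y : \bar R) := (0 <= x <= y)%E.
have /andP[] // : le0 (\prod_(i <- r | Q i) u i)%E (\prod_(i <- r | Q i) v i)%E.
elim/big_ind2 : _ => // [|x1 y1 x2 y2 /andP[x10 xy1] /andP[x20 xy2]].
  by rewrite /le0 lee01 lexx.
by rewrite /le0 mule_ge0 // lee_pmul.
Qed.

Section finite_random_elements.
Local Open Scope classical_set_scope.
Context (d : measure_display) (T : measurableType d) (R : realType).
Variable P : probability T R.
Implicit Types I S : finType.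

Lemma measurable_random_element_preimage S (X : T -> S) (A : set S) :
  random_element X -> measurable (X @^-1` A).
Proof.
move=> mX; rewrite -[A]image_id -bigcup_imset1 preimage_bigcup.
by apply: fin_bigcup_measurable => // s _; exact: mX.
Qed.

Lemma measurable_fun_random_element_comp S (d' : measure_display)
    (U : measurableType d') (X : T -> S) (phi : S -> U) :
  random_element X -> measurable_fun [set: T] (fun w => phi (X w)).
Proof.
move=> mX _ Y _; rewrite setTI.
exact: (measurable_random_element_preimage (phi @^-1` Y) mX).
Qed.

Lemma random_element_ffun I S (X : I -> T -> S) :
  (forall l, random_element (X l)) ->
  random_element (fun w => [ffun l => X l w]).
Proof.
move=> mX s.
have -> : (fun w => [ffun l => X l w]) @^-1` [set s] =
    \bigcap_(l in [set: I]) X l @^-1` [set s l].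
  apply/seteqP; split => [w /= <- l _ /=|w sX /=]; first by rewrite ffunE.
  by apply/ffunP => l; rewrite ffunE; exact: sX.
by apply: fin_bigcap_measurable => // l _; exact: mX.
Qed.

Lemma expectation_random_element S (X : T -> S) (phi : S -> R) :
  random_element X ->
  'E_P[fun w => phi (X w)]%E = (\sum_s (phi s)%:E * P (X @^-1` [set s]))%E.
Proof.
move=> mX; rewrite unlock.
under eq_integral => w _.
  have -> : (phi (X w))%:E =
      (\sum_s (phi s)%:E * (\1_(X @^-1` [set s]) w)%:E)%E.
    rewrite (bigD1 (X w)) //= big1 => [|s sX].
      by rewrite adde0 indicE mem_set //= mule1.
    by rewrite indicE memNset ?mule0 //= => /esym/eqP; exact/negP.
  over.
rewrite integral_sum //= => [|s]; last first.
  by apply: integrableZl => //; exact: integrable_indic.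
apply: eq_bigr => s _; rewrite integralZl //; last exact: integrable_indic.
by rewrite integral_indic // setIT.
Qed.

Lemma expectation_uniform S (X : T -> S) (phi : S -> R) :
  random_element X -> uniformly_distributed P X ->
  'E_P[fun w => phi (X w)]%E = (average phi)%:E.
Proof.
move=> mX uX; rewrite expectation_random_element //.
rewrite /average mulr_sumr -sumEFin; apply: eq_bigr => s _.
by rewrite uX -EFinM mulrC.
Qed.

Lemma probability_uniform S (X : T -> S) (A : pred S) :
  random_element X -> uniformly_distributed P X ->
  P (X @^-1` [set s | A s]) = (average (fun s => (A s)%:R))%:E.
Proof.
move=> mX uX; rewrite -(expectation_uniform _ mX uX) -expectation_indic.
  by congr ('E_P[_])%E; apply/funext => w; rewrite indicE mem_setE.
exact: measurable_random_element_preimage.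
Qed.

Lemma mutually_independent_probability_ge I S (X : I -> T -> S)
    (A : I -> set S) (p : R) :
  mutually_independent P X -> 0 <= p ->
  (forall l, p%:E <= P (X l @^-1` A l))%E ->
  ((p ^+ #|I|)%:E <= P (\bigcap_(l in [set` [set: I]%SET]) (X l @^-1` A l)))%E.
Proof.
move=> iX p0 pA; rewrite iX [leRHS](eq_bigl xpredT);
  last by move=> l; rewrite inE.
by rewrite -prodr_const -prodEFin lee_prod // => l _; rewrite lee_fin p0 pA.
Qed.

Lemma expectation_ge_probability (X : T -> R) (A : set T) (a : R) :
  measurable A -> measurable_fun [set: T] X -> (forall w, 0 <= X w) -> 0 <= a ->
  (forall w, A w -> a <= X w) -> (a%:E * P A <= 'E_P[X])%E.
Proof.
move=> mA mX X0 a0 aX; rewrite unlock -integral_cst //.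
apply: (@le_trans _ _ (\int[P]_(w in A) (X w)%:E)%E).
  apply: ge0_le_integral => //.
  by apply/measurable_EFinP; exact: measurable_funTS.
apply: ge0_subset_integral => //; first exact/measurable_EFinP.
by move=> w _; rewrite lee_fin.
Qed.

End finite_random_elements.

Section real_inequalities.
Variable R : realType.
Implicit Types x y s c : R.

(* Young's inequality applied to [x `^ s] and [y `^ (1 - s)] *)
Lemma powR_le_tangent s x y : 0 < s -> s < 1 -> 0 <= x -> 0 < y ->
  x `^ s <= y `^ s + s * y `^ (s - 1) * (x - y).
Proof.
move=> s0 s1 x0 y0; have s'0 : 0 < 1 - s by lra.
have := @conjugate_powR _ (x `^ s) (y `^ (1 - s)) s^-1 (1 - s)^-1.
rewrite !powR_ge0 => /(_ isT isT).
rewrite !invr_gt0 !invrK s0 s'0 addrC subrK -!powRrM => /(_ isT isT erefl).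
rewrite !divff ?gt_eqF // !powRr1 ?(ltW y0) // => young.
have yV : y `^ (1 - s) * y `^ (s - 1) = 1.
  by rewrite -powRD ?(gt_eqF y0) ?implybT // addrC subrKA subrr powRr0.
have ys : y `^ s = y * y `^ (s - 1).
  rewrite -{2}[y]powRr1 ?(ltW y0) // -powRD ?(gt_eqF y0) ?implybT //.
  by rewrite addrC subrK.
rewrite -[leLHS]mulr1 -{1}yV mulrA ys.
by apply: le_trans (ler_wpM2r (powR_ge0 _ _) young) _; lra.
Qed.

Lemma expRNV_le x : 0 < x -> expR (- x^-1) <= 1 - expR (- x).
Proof.
move=> x0; have xV0 : 0 < x^-1 by rewrite invr_gt0.
have invS_ge y : 0 < y -> expR (- y) <= (1 + y)^-1.
  by move=> y0; rewrite expRN lef_pV2 ?posrE ?expR_gt0 ?expR_ge1Dx //; lra.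
apply: le_trans (invS_ge _ xV0) _.
have -> : (1 + x^-1)^-1 = 1 - (1 + x)^-1 by field; rewrite !gt_eqF //; lra.
by rewrite lerD2l lerN2 invS_ge.
Qed.

Lemma expRN_le_exprn x c (k : nat) : 0 < x -> k%:R <= c * x ->
  expR (- c) <= (1 - expR (- x)) ^+ k.
Proof.
move=> x0 kcx; have le_expR := expRNV_le x0.
apply: (@le_trans _ _ (expR (- x^-1) ^+ k)).
  by rewrite -expRM_natl ler_expR mulrN lerN2 ler_pdivrMr.
by rewrite lerXn2r ?nnegrE ?expR_ge0 // (le_trans _ le_expR) ?expR_ge0.
Qed.

End real_inequalities.

Section zipf.
Variables (R : realType) (alpha : R).

Lemma zipfE (n : nat) (j : 'I_n) : zipf alpha j = j.+1%:R `^ (- alpha).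
Proof. by rewrite /zipf div1r powRN. Qed.

Lemma zipf_ge (n : nat) (j : 'I_n) : 0 <= alpha ->
  n%:R `^ (- alpha) <= zipf alpha j.
Proof.
move=> a0; have n0 : (0 < n)%N by exact: leq_ltn_trans (ltn_ord j).
rewrite zipfE !powRN lef_pV2 ?posrE ?powR_gt0 ?ltr0n //.
by rewrite ge0_ler_powR ?nnegrE ?ler0n // ler_nat.
Qed.

Lemma sum_zipf_le (n : nat) : 0 < alpha -> alpha < 1 ->
  \sum_(j < n) zipf alpha j <= n%:R `^ (1 - alpha) / (1 - alpha).
Proof.
move=> a0 a1; have s0 : 0 < 1 - alpha by lra.
under eq_bigr do rewrite zipfE.
rewrite ler_pdivlMr //; elim: n => [|n IHn].
  by rewrite big_ord0 mul0r powR_ge0.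
rewrite big_ord_recr /= mulrDl.
have := @powR_le_tangent R (1 - alpha) n%:R n.+1%:R.
rewrite s0 ler0n ltr0n => /(_ isT ltac:(lra) isT isT).
have -> : 1 - alpha - 1 = - alpha by ring.
by rewrite -natr1; lra.
Qed.

End zipf.

Section expected_error.
Local Open Scope classical_set_scope.
Context (d : measure_display) (T : measurableType d) (R : realType).
Variables (P : probability T R) (n B k : nat) (f : 'I_n -> R).
Variable h : 'I_k -> T -> {ffun 'I_n -> 'I_B}.
Hypotheses (B_gt0 : (0 < B)%N) (k_gt0 : (0 < k)%N).
Hypothesis f_ge0 : forall j, 0 <= f j.
Hypothesis h_random : forall l, random_element (h l).
Hypothesis h_uniform : forall l, uniformly_distributed P (h l).

Let error (i : 'I_n) (w : T) : R := count_min_error f (fun l => h l w) i.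

Lemma measurable_count_min_error i : measurable_fun [set: T] (error i).
Proof.
have -> : error i = fun w => count_min_error f [ffun l => h l w] i.
  apply/funext => w; congr (count_min_error f _ i).
  by apply/funext => l; rewrite ffunE.
apply: (measurable_fun_random_element_comp
  (fun g : {ffun 'I_k -> {ffun 'I_n -> 'I_B}} => count_min_error f g i)).
exact: random_element_ffun.
Qed.

Lemma expected_error_le i : ('E_P[error i] <= (B%:R^-1 * \sum_j f j)%:E)%E.
Proof.
apply: (@le_trans _ _ 'E_P[fun w => overload f (h (Ordinal k_gt0) w) i]%E).
  apply: expectation_le.
  - exact: measurable_count_min_error.
  - exact: (measurable_fun_random_element_comp (fun g => overload f g i)).
  - by move=> w; exact: normr_ge0.
  - by move=> w; exact: overload_ge0.
  - by apply: aeW => w; exact: (count_min_errorP _ i f_ge0 k_gt0).2.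
rewrite (expectation_uniform (fun g => overload f g i)) // lee_fin.
rewrite average_overload card_ord // ler_wpM2l ?invr_ge0 //.
by rewrite [leRHS](bigD1 i) //= lerDr.
Qed.

Hypothesis h_independent : mutually_independent P h.

Let quarter_mean : R := n.-1%:R / B%:R / 4.

Lemma expected_error_ge i (c : R) : 0 <= c -> (forall j, c <= f j) ->
  ((c * quarter_mean * (1 - expR (- quarter_mean)) ^+ k)%:E <= 'E_P[error i])%E.
Proof.
set x := quarter_mean => c0 cf; have x0 : 0 <= x by rewrite !divr_ge0.
have xE : x = mean_collisions 'I_B R i / 4.
  by rewrite mean_collisionsE !card_ord.
pose many := [set g : {ffun 'I_n -> 'I_B} | x <= (collisions g i)%:R].
pose all_many := \bigcap_(l in [set` [set: 'I_k]%SET]) h l @^-1` many.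
have prob_many l : ((1 - expR (- x))%:E <= P (h l @^-1` many))%E.
  rewrite (probability_uniform (fun g => x <= (collisions g i)%:R)) // lee_fin.
  by rewrite xE average_many_collisions_ge ?card_ord.
have prob_all : (((1 - expR (- x)) ^+ k)%:E <= P all_many)%E.
  rewrite -[k in (_ ^+ k)]card_ord.
  apply: (mutually_independent_probability_ge h_independent) => //.
  by rewrite subr_ge0 -expR0 ler_expR oppr_le0.
rewrite EFinM; apply: le_trans (lee_wpmul2l _ prob_all) _.
  by rewrite lee_fin mulr_ge0.
apply: expectation_ge_probability.
- apply: fin_bigcap_measurable => // l _.
  exact: measurable_random_element_preimage.
- exact: measurable_count_min_error.
- by move=> w; exact: normr_ge0.
- exact: mulr_ge0.
move=> w many_w; rewrite /error.
have [[l ->] _] := count_min_errorP (h^~ w) i f_ge0 k_gt0.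
apply: le_trans (overload_ge_collisions _ _ cf).
by rewrite ler_wpM2l //; apply: many_w; rewrite /= inE.
Qed.

Lemma expected_error_ge_load i (c : R) : 0 <= c -> (forall j, c <= f j) ->
  (1 < n)%N -> (k * B <= n)%N ->
  ((expR (- 8) / 8 * (c * (n%:R / B%:R)))%:E <= 'E_P[error i])%E.
Proof.
move=> c0 cf n1 kBn; apply: le_trans (expected_error_ge i c0 cf).
set x := quarter_mean; have B0 : 0 < B%:R :> R by rewrite ltr0n.
have nx : n%:R / B%:R <= 8 * x.
  have n2 : n%:R <= 2 * n.-1%:R :> R.
    rewrite -natrM ler_nat -[leqLHS](prednK (ltnW n1)) mul2n -addnn -addn1.
    by rewrite leq_add2l -ltnS prednK // ltnW.
  have -> : 8 * x = 2 * n.-1%:R / B%:R.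
    by rewrite /x /quarter_mean; field; rewrite gt_eqF.
  by rewrite ler_pM2r ?invr_gt0.
have kx : k%:R <= 8 * x.
  by apply: le_trans nx; rewrite ler_pdivlMr // -natrM ler_nat.
have x0 : 0 < x by rewrite !divr_gt0 ?ltr0n // -subn1 subn_gt0.
have powk := expRN_le_exprn x0 kx.
have -> : expR (- 8) / 8 * (c * (n%:R / B%:R)) =
    c * (n%:R / B%:R / 8) * expR (- 8).
  by field; rewrite gt_eqF.
rewrite lee_fin ler_pM ?expR_ge0 //; first by rewrite mulr_ge0 ?divr_ge0.
by rewrite ler_wpM2l // ler_pdivrMr // [leRHS]mulrC.
Qed.

End expected_error.

Theorem theoremA1 (R : realType) (alpha : R) (alpha_gt0 : 0 < alpha)
    (alpha_lt1 : alpha < 1) :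
  exists c C : R, 0 < c /\ 0 < C /\
    forall (n B k : nat), (0 < B)%N -> (1 <= k)%N -> B%:R <= n%:R / k%:R :> R ->
    forall (d : measure_display) (T : measurableType d) (P : probability T R)
      (h : 'I_k -> T -> {ffun 'I_n -> 'I_B}),
      (forall l, random_element (h l)) ->
      (forall l, uniformly_distributed P (h l)) ->
      mutually_independent P h ->
    forall i : 'I_n,
      let f := zipf alpha (n := n) in
      let err := fun w : T => `|count_min f (fun l => h l w) i - f i| in
      ('E_P[err] <= (C * (n%:R `^ (1 - alpha) / B%:R))%:E)%E /\
      ((1 < n)%N -> ((c * (n%:R `^ (1 - alpha) / B%:R))%:E <= 'E_P[err])%E).
Proof.
exists (expR (- 8) / 8), (1 - alpha)^-1.
split; first by rewrite divr_gt0 ?expR_gt0.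
split; first by rewrite invr_gt0; lra.
move=> n B k B0 k0 Bnk d T P h rh uh ih i /=.
have f0 := @zipf_ge0 R alpha n; split => [|n1].
  apply: le_trans (expected_error_le B0 k0 f0 rh uh i) _.
  rewrite lee_fin mulrA [leRHS]mulrC ler_wpM2l ?invr_ge0 //.
  by rewrite [leRHS]mulrC sum_zipf_le.
have kBn : (k * B <= n)%N.
  by move: Bnk; rewrite ler_pdivlMr ?ltr0n // -natrM ler_nat mulnC.
have powE : n%:R `^ (1 - alpha) = n%:R `^ (- alpha) * n%:R.
  by rewrite addrC powRD ?powRr1 // pnatr_eq0 -lt0n (ltnW n1) implybT.
rewrite powE -[_ * _ / _]mulrA; apply: expected_error_ge_load => // j.
exact: zipf_ge (ltW alpha_gt0).
Qed.
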